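(* Let $\mathbb{F}$ be an algebraically closed field, let $n$ be a positive integer, and let $Q\subseteq\{2,\ldots,n\}$ be non-empty. Then $M(Q)\in\mathcal{M}_n$ if and only if there exists a number $m_0\in\{2,\ldots,\lfloor n/2\rfloor+1\}$ such that: (1) $m_0=\lfloor n/2\rfloor+1$ or $m_0=(\operatorname{char}\mathbb{F})^k$ for some positive integer $k$; (2) $2,\ldots,m_0\in Q$; (3) for every $m\in Q$ with $m_0+1\le m\le n$ one has $n-m_0+2\le m\le 2m_0$.
   Context: Let $A=M_n(\mathbb{F})$. $\mathcal{M}_n$ denotes the family of all subsets $M\subseteq A$ consisting of nilpotent matrices such that: (i) $0\in M$; (ii) $gMg^{-1}=M$ for every invertible $g\in A$; (iii) for all $X,Y\in M$ with $XY=YX$, the linear span $\langle X,Y\rangle$ is contained in $M$. For $Q\subseteq\{2,\ldots,n\}$, $M(Q)$ denotes the set of all nilpotent matrices $X\in A$ such that all Jordan cells (blocks) in the Jordan form of $X$ have sizes belonging to $Q\cup\{1\}$. *)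

(* Defs.v *)
From HB Require Import structures.
From mathcomp Require Import all_boot all_order all_algebra.

Set Implicit Arguments.
Unset Strict Implicit.
Unset Printing Implicit Defensive.

Import GRing.Theory.
Local Open Scope ring_scope.

Definition nilpotent_mx (F : fieldType) (n : nat) (X : 'M[F]_n) : Prop :=
  exists k : nat, X ^+ k = 0.

Definition jordan_cell (F : fieldType) (a : F) (k : nat) : 'M[F]_k :=
  a%:M + \matrix_(i < k, j < k) (i.+1 == j :> nat)%:R.

(* The block-diagonal matrix lives in 'M_(\sum_i d i), hence the cast along
   the equation \sum_i d i = n; cells are required to have positive size. *)
Definition jordan_form (F : fieldType) (n : nat) (X : 'M[F]_n)
    (r : nat) (a : 'I_r -> F) (d : 'I_r -> nat) : Prop :=
  (forall i, (0 < d i)%N) /\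
  exists (e : (\sum_i d i)%N = n) (P : 'M[F]_n),
    P \in unitmx /\
    X = P *m castmx (e, e) (\mxdiag_(i < r) jordan_cell (a i) (d i)) *m invmx P.

(* Subsets of M_n(F) are predicates. *)
Definition calM (F : fieldType) (n : nat) (M : 'M[F]_n -> Prop) : Prop :=
  [/\ forall X, M X -> nilpotent_mx X,
      M 0,
      forall g : 'M[F]_n, g \in unitmx ->
        forall Y, (exists2 X, M X & Y = g *m X *m invmx g) <-> M Y
    & forall X Y, M X -> M Y -> X *m Y = Y *m X ->
        forall Z, Z \in <<[:: X; Y]>>%VS -> M Z].

(* The Jordan form is unique up to the order of the cells, so one may ask for
   some Jordan form with the required cell sizes. *)
Definition MQ (F : fieldType) (n : nat) (Q : {pred nat}) (X : 'M[F]_n) : Prop :=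
  nilpotent_mx X /\
  exists (r : nat) (a : 'I_r -> F) (d : 'I_r -> nat),
    jordan_form X a d /\ forall i, d i \in Q \/ d i = 1%N.

(* Main.v *)
Require Import Defs.
From HB Require Import structures.
From mathcomp Require Import all_boot all_order all_algebra.
From mathcomp Require Import zify ring.

Set Implicit Arguments.
Unset Strict Implicit.
Unset Printing Implicit Defensive.
Import GRing.Theory.
Local Open Scope ring_scope.

(** Everything rests on the Jordan types of the matrices in a commutative
    algebra of nilpotent matrices. Vectors are rows, so matrices act on the
    right.

    Sufficiency. Suppose that [X], nilpotent of size [n], has index of
    nilpotency [k + 1], so that a cell of size [k + 1] splits off, and that the
    complementary dimension [n - (k + 1)] is at most [m0 - 2], while
    [m0 <= k < 2 * m0]. Write a nilpotent [Z] commuting with [X] in blocks along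
    this splitting. Its action on the big cell is a polynomial in the cell
    without constant term; let [alpha] be the linear coefficient. The two
    off-diagonal blocks pass through a space that is too small for them to
    interfere: if [alpha <> 0] then [Z] has index [k + 1] too, and if
    [alpha = 0] then [Z ^ m0 = 0] ([dominant_cell_commutant]). Two filtrations
    that [Z] shifts make this precise. Now let [X] and [Y] be commuting members
    of [MQ Q] and let [Z] be a linear combination of them. If [X ^ m0 <> 0] then
    the last condition on [Q] says that [X] is as above, and either outcome puts [Z] in
    [MQ Q]; likewise for [Y]. If [X ^ m0 = Y ^ m0 = 0] then [Z ^ m0 = 0]: by the
    Frobenius identity if [m0] is a power of the characteristic; and if
    [m0 = n / 2 + 1], because a nonzero [Z ^ m0] would make [Z] itself a matrix
    as above, so that the linear coefficient of [X] or [Y] relative to [Z] would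
    be nonzero and their index would exceed [m0].

    Necessity. If [m] is in [Q] and [J] is the cell of size [m], then [J] and
    [J ^ j - J] are similar for [j > 1], so [Q] contains the index of their sum
    [J ^ j] when it exceeds 1 ([calM_cell_power]). In particular 2 is in [Q],
    and a largest [m0 <= n / 2 + 1] with [2, ..., m0] in [Q] exists. If
    [m0 <= n / 2] then [m0 + 1] is not in [Q], and two chains [x] and [y] with
    [x y = y x = 0] and [x ^ r = y ^ s <> 0], acting on a space of dimension
    [r + s] ([crossing_chains]), give the rest. For [r = s = m0] and
    [b ^ m0 = -1], the matrix [x + b y] has zero [m0]-th power; with two such
    scalars [b], the matrix [x], of index [m0 + 1], would be a combination of
    members of [MQ Q]. So there is only one, that is, no root of unity other
    than 1 has order dividing [m0], and [m0] is a power of the characteristic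
    ([calM_prime_power]). For [r = m - 1] and [s = m0], where [m] is in [Q] and
    [m > m0], both [x] and [y - x] would be members of [MQ Q] if there were room
    for them, although their sum [y] has index [m0 + 1]; hence
    [n - m0 + 2 <= m] ([calM_gap]). Finally [m > 2 * m0] would contradict this
    bound for the upper half of [m], which is in [Q] together with [m]. *)

(** * Matrices of partial self-maps of an initial segment *)

(** Values of [f] that are at least [n] give zero rows: they encode the points
    where a partial map is not defined. *)
Definition fun_mx (F : fieldType) (n : nat) (f : nat -> nat) : 'M[F]_n :=
  \matrix_(i, j) (f i == j)%:R.

Lemma eq_fun_mx (F : fieldType) (n : nat) (f g : nat -> nat) :
  (forall i, i < n -> f i = g i)%N -> fun_mx F n f = fun_mx F n g.
Proof. by move=> fg; apply/matrixP => i j; rewrite !mxE fg. Qed.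

Lemma fun_mx_eq0 (F : fieldType) (n : nat) (f : nat -> nat) :
  (forall i, i < n -> n <= f i)%N -> fun_mx F n f = 0.
Proof.
move=> fn; apply/matrixP => i j; rewrite !mxE.
by case: eqP (fn i (ltn_ord i)) => // -> /=; rewrite leqNgt ltn_ord.
Qed.

Lemma fun_mx_neq0 (F : fieldType) (n : nat) (f : nat -> nat) (i : nat) :
  (i < n)%N -> (f i < n)%N -> fun_mx F n f != 0.
Proof.
move=> i_lt fi_lt; apply/matrix0Pn; exists (Ordinal i_lt), (Ordinal fi_lt).
by rewrite mxE eqxx oner_neq0.
Qed.

Lemma fun_mxM (F : fieldType) (n : nat) (f g : nat -> nat) :
  (forall i, n <= i -> n <= g i)%N ->
  fun_mx F n f *m fun_mx F n g = fun_mx F n (g \o f).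
Proof.
move=> gn; apply/matrixP => i j; rewrite !mxE /=.
have [fi_lt|fi_ge] := ltnP (f i) n.
  rewrite (bigD1 (Ordinal fi_lt)) //= !mxE eqxx mul1r big1 ?addr0 // => h.
  by rewrite -val_eqE /= eq_sym => /negPf h_neq; rewrite !mxE h_neq mul0r.
rewrite big1 => [|h _].
  by case: eqP (gn _ fi_ge) => // ->; rewrite leqNgt ltn_ord.
by rewrite !mxE; case: eqP fi_ge => [->|]; rewrite ?mul0r // leqNgt ltn_ord.
Qed.

Lemma fun_mxX (F : fieldType) (n : nat) (f : nat -> nat) (k : nat) :
  (forall i, n <= i -> n <= f i)%N ->
  fun_mx F n f ^+ k = fun_mx F n (iter k f).
Proof.
move=> fn; elim: k => [|k IHk]; last by rewrite exprSr IHk -mulmxE fun_mxM.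
by apply/matrixP => i j; rewrite !mxE.
Qed.

(** * The nilpotent cell *)

Notation cell0 F m := (jordan_cell (0 : F) m).

Lemma cell0X (F : fieldType) (m k : nat) :
  cell0 F m ^+ k = fun_mx F m (addn k).
Proof.
have -> : cell0 F m = fun_mx F m succn.
  by apply/matrixP => i j; rewrite !mxE mul0rn add0r.
rewrite fun_mxX => [|i /leqW //].
by apply: eq_fun_mx => i _; rewrite iter_succn addnC.
Qed.

Lemma cell0X_eq0 (F : fieldType) (m k : nat) :
  (cell0 F m ^+ k == 0) = (m <= k)%N.
Proof.
rewrite cell0X; have [m_le|k_lt] := leqP m k.
  by rewrite fun_mx_eq0 ?eqxx // => i _; apply: leq_trans (leq_addr _ _).
by apply/negbTE/(@fun_mx_neq0 _ _ _ 0%N); lia.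
Qed.

Lemma mul_cell0X (F : fieldType) (p m k : nat) (M : 'M[F]_(p, m)) i (h j : 'I_m) :
  (k + h)%N = j -> (M *m cell0 F m ^+ k) i j = M i h.
Proof.
move=> khj; rewrite cell0X mxE (bigD1 h) //= !mxE khj eqxx mulr1.
rewrite big1 ?addr0 // => l /eqP lh; rewrite mxE -khj eqn_add2l.
by case: eqP => [/val_inj //|_]; rewrite mulr0.
Qed.

Lemma mul_cell0X_lt (F : fieldType) (p m k : nat) (M : 'M[F]_(p, m)) i (j : 'I_m) :
  (j < k)%N -> (M *m cell0 F m ^+ k) i j = 0.
Proof.
move=> j_lt; rewrite cell0X mxE big1 // => l _; rewrite !mxE.
by case: eqP => [|_]; rewrite ?mulr0 //; lia.
Qed.

(** Exactness: the kernel of the [l]-th power of a cell of size [m] is the image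
    of its [(m - l)]-th power, so annihilation amounts to divisibility. *)
Lemma cell0_factor (F : fieldType) (p m k l : nat) (M : 'M[F]_(p, m)) :
  M *m cell0 F m ^+ l = 0 -> (k + l <= m)%N ->
  exists M', M = M' *m cell0 F m ^+ k.
Proof.
move=> Ml0 kl; exists (M *m (cell0 F m ^+ k)^T); apply/matrixP => i j.
have [j_lt|k_le] := ltnP j k.
  rewrite mul_cell0X_lt //.
  have jl : (l + j < m)%N by lia.
  by rewrite -(mul_cell0X M i (j := Ordinal jl) (erefl _)) Ml0 mxE.
have jk : (j - k < m)%N by apply: leq_ltn_trans (leq_subr _ _) (ltn_ord j).
rewrite (mul_cell0X _ _ (h := Ordinal jk)) /= ?subnKC //.
rewrite mxE (bigD1 j) //= !cell0X !mxE /= subnKC // eqxx mulr1.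
rewrite big1 ?addr0 // => h; rewrite -val_eqE !mxE /= subnKC // eq_sym.
by move=> /negPf ->; rewrite mulr0.
Qed.

(** * Similarity of square matrices of possibly distinct formal sizes *)

(** The sizes are allowed to differ syntactically; they are equal by
    [similar_size]. This avoids casts when a matrix is cut into blocks. *)
Definition similar (F : fieldType) (n k : nat) (X : 'M[F]_n) (Y : 'M[F]_k) :=
  exists A : 'M_(n, k), exists B : 'M_(k, n),
    [/\ A *m B = 1%:M, B *m A = 1%:M & X = A *m Y *m B].

Lemma similar_refl (F : fieldType) (n : nat) (X : 'M[F]_n) : similar X X.
Proof. by exists 1%:M, 1%:M; rewrite !mulmx1 mul1mx. Qed.

Lemma similar_sym (F : fieldType) (n k : nat) (X : 'M[F]_n) (Y : 'M[F]_k) :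
  similar X Y -> similar Y X.
Proof.
move=> [A [B [AB BA ->]]]; exists B, A; split=> //.
by rewrite !mulmxA BA mul1mx -mulmxA BA mulmx1.
Qed.

Lemma similar_trans (F : fieldType) (n k l : nat)
    (X : 'M[F]_n) (Y : 'M[F]_k) (Z : 'M[F]_l) :
  similar X Y -> similar Y Z -> similar X Z.
Proof.
move=> [A [B [AB BA ->]]] [C [D [CD DC ->]]]; exists (A *m C), (D *m B).
split; last by rewrite !mulmxA.
- by rewrite mulmxA -(mulmxA A) CD mulmx1.
- by rewrite mulmxA -(mulmxA D) BA mulmx1.
Qed.

Lemma similar_size (F : fieldType) (n k : nat) (X : 'M[F]_n) (Y : 'M[F]_k) :
  similar X Y -> n = k.
Proof.
by move=> [A [B [AB BA _]]]; apply/eqP; rewrite eqn_leq (mulmx1_min AB) (mulmx1_min BA).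
Qed.

Lemma similarX (F : fieldType) (n k e : nat) (X : 'M[F]_n) (Y : 'M[F]_k) :
  similar X Y -> similar (X ^+ e) (Y ^+ e).
Proof.
move=> [A [B [AB BA ->]]]; exists A, B; split=> //.
elim: e => [|e IHe]; first by rewrite !expr0 mulmx1 AB.
by rewrite !exprSr IHe -!mulmxE !mulmxA -(mulmxA _ B A) BA mulmx1.
Qed.

Lemma similar_eq0 (F : fieldType) (n k : nat) (X : 'M[F]_n) (Y : 'M[F]_k) :
  similar X Y -> (X == 0) = (Y == 0).
Proof.
move=> XY; apply/eqP/eqP; last by move: XY => [A [B [_ _ ->]]] ->; rewrite mulmx0 mul0mx.
by move: (similar_sym XY) => [A [B [_ _ ->]]] ->; rewrite mulmx0 mul0mx.
Qed.

Lemma similarX_eq0 (F : fieldType) (n k e : nat) (X : 'M[F]_n) (Y : 'M[F]_k) :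
  similar X Y -> (X ^+ e == 0) = (Y ^+ e == 0).
Proof. by move=> /(similarX e) /similar_eq0. Qed.

Lemma similar_castmx (F : fieldType) (n k : nat) (e : n = k) (X : 'M[F]_n) :
  similar (castmx (e, e) X) X.
Proof. by case: k / e; rewrite castmx_id; apply: similar_refl. Qed.

Lemma similar_block (F : fieldType) (n k n' k' : nat)
    (X : 'M[F]_n) (Y : 'M[F]_k) (X' : 'M[F]_n') (Y' : 'M[F]_k') :
  similar X X' -> similar Y Y' ->
  similar (block_mx X 0 0 Y) (block_mx X' 0 0 Y').
Proof.
move=> [A [B [AB BA ->]]] [C [D [CD DC ->]]].
exists (block_mx A 0 0 C), (block_mx B 0 0 D).
by rewrite !mulmx_block !(mulmx0, mul0mx, addr0, add0r) AB BA CD DC -!scalar_mx_block.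
Qed.

Lemma similar_blockA (F : fieldType) (n k l : nat)
    (X : 'M[F]_n) (Y : 'M[F]_k) (Z : 'M[F]_l) :
  similar (block_mx X 0 0 (block_mx Y 0 0 Z))
          (block_mx (block_mx X 0 0 Y) 0 0 Z).
Proof.
rewrite -[X in block_mx _ X]row_mx0 -[X in block_mx _ _ X]col_mx0 block_mxA.
by rewrite row_mx0 col_mx0; apply: similar_castmx.
Qed.

Lemma block_diagX (F : fieldType) (n k e : nat) (X : 'M[F]_n) (Y : 'M[F]_k) :
  block_mx X 0 0 Y ^+ e = block_mx (X ^+ e) 0 0 (Y ^+ e).
Proof.
elim: e => [|e IHe]; first by rewrite !expr0 -scalar_mx_block.
by rewrite !exprSr IHe -!mulmxE mulmx_block !(mulmx0, mul0mx, addr0, add0r).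
Qed.

Lemma block_diag_eq0 (F : fieldType) (n k : nat) (X : 'M[F]_n) (Y : 'M[F]_k) :
  (block_mx X 0 0 Y == 0) = (X == 0) && (Y == 0).
Proof. by rewrite block_mx_eq0 !eqxx. Qed.

(** * Jordan form of nilpotent matrices *)

(** The size has to be positive, because the unique matrix of size 0 already has
    zero power of exponent 0. *)
Lemma nilpotent_index (F : fieldType) (n e : nat) (X : 'M[F]_n) :
  (0 < n)%N -> X ^+ e = 0 -> exists2 k, X ^+ k != 0 & X ^+ k.+1 = 0.
Proof.
move=> n_gt0; elim: e => [/eqP|e IHe Xe].
  rewrite expr0 => /eqP/matrixP/(_ (Ordinal n_gt0) (Ordinal n_gt0))/eqP.
  by rewrite !mxE eqxx oner_eq0.
by have [/eqP /IHe //|Xe0] := boolP (X ^+ e == 0); exists e.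
Qed.

(** A longest chain [v, vX, ..., vX^k] splits off: a linear form that does not
    vanish on [vX^k] yields, with its images under the transpose of [X], a dual
    chain, whose annihilator is an invariant complement. *)
Lemma split_longest_cell (F : fieldType) (n k : nat) (X : 'M[F]_n) :
  X ^+ k != 0 -> X ^+ k.+1 = 0 ->
  exists D (T : 'M[F]_D), similar X (block_mx (cell0 F k.+1) 0 0 T).
Proof.
move=> /matrix0Pn [i [j Xij]] Xk0.
have X0 e : (k < e)%N -> X ^+ e = 0.
  by move=> ke; rewrite -(subnKC ke) exprD Xk0 mul0r.
(* The rows of [E] form the chain, the columns of [Phi] the dual chain. *)
pose E : 'M_(k.+1, n) := \matrix_(h, l) (X ^+ h) i l.
pose Phi : 'M_(n, k.+1) := \matrix_(l, h) ((X ^+ (k - h)) l j / (X ^+ k) i j).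
have EPhi h h' : (E *m Phi) h h' = (X ^+ (h + (k - h'))) i j / (X ^+ k) i j.
  rewrite exprD -mulmxE !mxE mulr_suml; apply: eq_bigr => l _.
  by rewrite !mxE mulrA.
have uEPhi : E *m Phi \in unitmx.
  rewrite unitmxE -det_tr det_trig; last first.
    apply/is_trig_mxP => h h' hh'; rewrite mxE EPhi X0 ?mxE ?mul0r //.
    by have := ltn_ord h'; lia.
  rewrite big1 ?unitr1 // => h _; rewrite mxE EPhi.
  by rewrite subnKC ?divff // -ltnS ltn_ord.
have EX : E *m X = cell0 F k.+1 *m E.
  apply/matrixP => h l.
  have -> : (E *m X) h l = (X ^+ h.+1) i l.
    by rewrite exprSr -mulmxE !mxE; apply: eq_bigr => g _; rewrite mxE.
  rewrite -[cell0 F _]expr1 cell0X mxE.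
  have [h_lt|h_ge] := ltnP h k.
    have h_lt' : (h.+1 < k.+1)%N by [].
    rewrite (bigD1 (Ordinal h_lt')) //= big1 ?addr0.
      by rewrite !mxE add1n eqxx mul1r.
    by move=> g; rewrite -val_eqE /= !mxE add1n eq_sym => /negPf ->; rewrite mul0r.
  rewrite X0 // mxE big1 // => g _; rewrite !mxE.
  by case: eqP => [|_]; rewrite ?mul0r //; have := ltn_ord g; lia.
have XPhi : X *m Phi = Phi *m cell0 F k.+1.
  apply/matrixP => l h.
  have -> : (X *m Phi) l h = (X ^+ (k - h).+1) l j / (X ^+ k) i j.
    rewrite exprS -mulmxE !mxE mulr_suml; apply: eq_bigr => g _.
    by rewrite mxE mulrA.
  rewrite -[cell0 F _]expr1; case: (posnP h) => [h0|h_gt0].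
    by rewrite mul_cell0X_lt ?h0 // subn0 Xk0 mxE mul0r.
  have h_lt : (h.-1 < k.+1)%N by have := ltn_ord h; lia.
  rewrite (mul_cell0X _ _ (h := Ordinal h_lt)) /= ?add1n ?prednK // mxE /=.
  by have -> : (k - h.-1 = (k - h).+1)%N by have := ltn_ord h; lia.
(* [W] is a basis of the annihilator of the dual chain. *)
pose W := row_base (kermx Phi).
have WPhi : W *m Phi = 0 by apply/sub_kermxP; rewrite eq_row_base.
have [T WX] : exists T, W *m X = T *m W.
  apply/submxP; rewrite eq_row_base; apply/sub_kermxP.
  by rewrite -mulmxA XPhi mulmxA WPhi mul0mx.
exists _, T; apply: similar_sym.
pose P := col_mx E W.
have PX : P *m X = block_mx (cell0 F k.+1) 0 0 T *m P.
  by rewrite mul_col_mx EX WX mul_block_col !mul0mx addr0 add0r.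
have freeP : row_free P.
  rewrite -kermx_eq0; apply/rowV0P => v /sub_kermxP.
  rewrite -[v]hsubmxK mul_row_col => v0.
  have v1 : lsubmx v = 0.
    apply: (can_inj (mulmxK uEPhi)); rewrite mul0mx mulmxA.
    move/(congr1 (mulmx^~ Phi)): v0; rewrite mulmxDl mul0mx.
    by rewrite -(mulmxA _ W) WPhi mulmx0 addr0.
  move: v0; rewrite v1 mul0mx add0r => /eqP.
  by rewrite mulmx_free_eq0 ?row_base_free // => /eqP ->; rewrite row_mx0.
have fullP : row_full P.
  have /eqP rP : row_free P by [].
  rewrite /row_full rP mxrank_ker.
  have -> : \rank Phi = k.+1.
    apply/eqP; rewrite eqn_leq rank_leq_col /=.
    by rewrite -{1}(mxrank_unit uEPhi) mxrankM_maxr.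
  rewrite subnKC // -{1}(mxrank_unit uEPhi).
  exact: leq_trans (mxrankM_maxl _ _) (rank_leq_col _).
have [B PB] := row_freeP freeP; have [C CP] := row_fullP fullP.
have BC : B = C by rewrite -[B]mul1mx -CP -mulmxA PB mulmx1.
exists P, B; split=> //; first by rewrite BC.
by rewrite PX -mulmxA PB mulmx1.
Qed.

(** The recursive nesting of blocks makes the size [sumn s] unfold with the list,
    so that no cast occurs. *)
Fixpoint jordan_cells (F : fieldType) (s : seq nat) : 'M[F]_(sumn s) :=
  match s with
  | [::] => 0
  | d :: s' => block_mx (cell0 F d) 0 0 (jordan_cells F s')
  end.

Lemma jordan_cellsX_eq0 (F : fieldType) (s : seq nat) (k : nat) :
  (jordan_cells F s ^+ k == 0) = all (fun d => d <= k)%N s.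
Proof.
elim: s => [|d s IHs] /=; first by apply/eqP/matrixP => -[].
by rewrite block_diagX block_diag_eq0 cell0X_eq0 IHs.
Qed.

Lemma nilpotent_similar_cells (F : fieldType) (n e : nat) (X : 'M[F]_n) :
  X ^+ e = 0 ->
  exists2 s, all (leq 1) s & similar X (jordan_cells F s).
Proof.
elim/ltn_ind: n X => n IHn X Xe.
case: (posnP n) => [n0|n_gt0].
  exists [::] => //=; subst n; exists 0, 0.
  by split; apply/matrixP => -[].
have [k Xk Xk1] := nilpotent_index n_gt0 Xe.
have [D [T XT]] := split_longest_cell Xk Xk1.
have nD := similar_size XT.
have /eqP Te : T ^+ e == 0.
  by move/eqP: Xe; rewrite (similarX_eq0 _ XT) block_diagX block_diag_eq0 => /andP[].
have [|s s_gt0 Ts] := IHn D _ T Te; first by rewrite nD; lia.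
exists (k.+1 :: s) => //=.
by apply: similar_trans XT (similar_block (similar_refl _) Ts).
Qed.

(** The last basis vector is an eigenvector of the cell. *)
Lemma nilpotent_cell (F : fieldType) (a : F) (d e : nat) :
  (0 < d)%N -> jordan_cell a d ^+ e = 0 -> a = 0.
Proof.
case: d => // d _ ae.
pose v : 'rV[F]_d.+1 := delta_mx 0 ord_max.
have va : v *m jordan_cell a d.+1 = a *: v.
  rewrite /jordan_cell mulmxDr mul_mx_scalar -rowE (_ : row _ _ = 0) ?addr0 //.
  by apply/rowP => j; rewrite !mxE /=; case: eqP => // dj; have := ltn_ord j; lia.
have vae : v *m jordan_cell a d.+1 ^+ e = a ^+ e *: v.
  elim: e {ae} => [|e IHe]; first by rewrite !expr0 scale1r mulmx1.
  by rewrite exprSr -mulmxE mulmxA IHe -scalemxAl va scalerA exprSr.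
move/eqP: vae; rewrite ae mulmx0 eq_sym scaler_eq0 expf_eq0 => /orP[/andP[_ /eqP //]|].
by move=> /eqP/rowP/(_ ord_max)/eqP; rewrite !mxE !eqxx oner_eq0.
Qed.

Lemma mxdiag_similar_cells (F : fieldType) (r e : nat) (a : 'I_r -> F) (d : 'I_r -> nat) :
  (forall i, 0 < d i)%N ->
  (\mxdiag_(i < r) jordan_cell (a i) (d i)) ^+ e = 0 ->
  exists2 s, (forall x, x \in s -> exists i, x = d i)
           & similar (\mxdiag_(i < r) jordan_cell (a i) (d i)) (jordan_cells F s).
Proof.
elim: r a d => [|r IHr] a d d_gt0 nil_ad.
  exists [::] => //; have e0 : (\sum_(i < 0) d i)%N = 0%N by rewrite big_ord0.
  exists 0, 0; split; apply/matrixP => i j //; suff : false by [].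
  - by move: (ltn_ord i); rewrite {2}e0.
  - by case: i.
  - by move: (ltn_ord i); rewrite {2}e0.
have diagE : similar (\mxdiag_(i < r.+1) jordan_cell (a i) (d i))
    (block_mx (jordan_cell (a ord0) (d ord0)) 0 0
      (\mxdiag_(i < r) jordan_cell (a (lift ord0 i)) (d (lift ord0 i)))).
  by rewrite mxdiag_recl; apply: similar_castmx.
have := similarX_eq0 e diagE; rewrite nil_ad eqxx block_diagX block_diag_eq0.
move=> /esym/andP[/eqP nil0 /eqP nilS].
have a0 := nilpotent_cell (d_gt0 _) nil0.
have [s sd ss] := IHr _ _ (fun i => d_gt0 _) nilS.
exists (d ord0 :: s).
  move=> x; rewrite inE => /orP[/eqP ->|/sd [i ->]]; first by exists ord0.
  by exists (lift ord0 i).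
apply: similar_trans diagE _; rewrite /= a0.
exact: similar_block (similar_refl _) ss.
Qed.

Lemma cells_similar_mxdiag (F : fieldType) (s : seq nat) :
  similar (jordan_cells F s) (\mxdiag_(i < size s) cell0 F (nth 0%N s i)).
Proof.
elim: s => [|d s IHs] /=.
  have e0 : (\sum_(i < 0) nth 0%N [::] i)%N = 0%N by rewrite big_ord0.
  exists 0, 0; split; apply/matrixP => i j //; suff : false by [].
  - by case: i.
  - by move: (ltn_ord i); rewrite {2}e0.
  - by case: i.
apply: similar_trans (similar_block (similar_refl _) IHs) _.
apply: similar_sym; rewrite mxdiag_recl; exact: similar_castmx.
Qed.

(** A list-based description of [MQ]: the eigenvalues of the cells are zero
    because the matrix is nilpotent. *)
Lemma MQ_cells (F : fieldType) (n : nat) (Q : {pred nat}) (X : 'M[F]_n) :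
  MQ Q X <->
  exists s, [/\ all (leq 1) s, forall d, d \in s -> d \in Q \/ d = 1%N
              & similar X (jordan_cells F s)].
Proof.
split=> [[[e Xe] [r [a [d [[d_gt0 [En [P [uP XP]]]] dQ]]]]]|].
  have sXd : similar X (\mxdiag_(i < r) jordan_cell (a i) (d i)).
    apply: similar_trans (similar_castmx En _).
    by exists P, (invmx P); rewrite mulmxV ?mulVmx.
  move/eqP: Xe; rewrite (similarX_eq0 _ sXd) => /eqP /(mxdiag_similar_cells d_gt0).
  move=> [s sd ss]; exists s; split.
  - by apply/allP => x /sd [i ->]; apply: d_gt0.
  - by move=> x /sd [i ->]; apply: dQ.
  - exact: similar_trans sXd ss.
move=> [s [/allP s_gt0 sQ sXs]]; split.
  exists (sumn s); apply/eqP; rewrite (similarX_eq0 _ sXs) jordan_cellsX_eq0.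
  apply/allP => d ds; elim: s {s_gt0 sQ sXs} ds => //= c s IHs; rewrite inE.
  by move=> /orP[/eqP ->|/IHs]; lia.
exists (size s), (fun=> 0), (fun i => nth 0%N s i); split; last first.
  by move=> i; apply: sQ; apply: mem_nth.
split=> [i|]; first by apply: s_gt0; apply: mem_nth.
have sXd := similar_trans sXs (cells_similar_mxdiag F s).
have En := esym (similar_size sXd); exists En.
have := similar_trans sXd (similar_sym (similar_castmx En _)).
move=> [A [B [AB BA XAB]]]; have [uA _] := mulmx1_unit AB.
exists A; split=> //; rewrite XAB; congr (_ *m _).
by rewrite -[B]mul1mx -(mulVmx uA) -mulmxA AB mulmx1.
Qed.
(** * Membership in [MQ] *)

Lemma similar_block0 (F : fieldType) (n : nat) (Z : 'M[F]_0) (Y : 'M[F]_n) :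
  similar (block_mx Z 0 0 Y) Y.
Proof.
exists (col_mx 0 1%:M), (row_mx 0 1%:M); split.
- by rewrite mul_col_row !(mulmx0, mul0mx) mulmx1 [RHS](@scalar_mx_block F 0 n 1) (flatmx0 1%:M).
- by rewrite mul_row_col mulmx1 mulmx0 add0r.
rewrite mul_col_mx mul0mx mul1mx mul_col_row !(mulmx0, mul0mx) mulmx1.
by rewrite (flatmx0 Z).
Qed.

Lemma jordan_cells_cat (F : fieldType) (s t : seq nat) :
  similar (jordan_cells F (s ++ t))
          (block_mx (jordan_cells F s) 0 0 (jordan_cells F t)).
Proof.
elim: s => [|d s IHs] /=; first exact: similar_sym (similar_block0 _ _).
apply: similar_trans (similar_block (similar_refl _) IHs) _.
exact: similar_blockA.
Qed.

Lemma MQ_block (F : fieldType) (n k : nat) (Q : {pred nat}) (X : 'M[F]_n) (Y : 'M[F]_k) :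
  MQ Q X -> MQ Q Y -> MQ Q (block_mx X 0 0 Y).
Proof.
move=> /MQ_cells [s [s_gt0 sQ Xs]] /MQ_cells [t [t_gt0 tQ Yt]].
apply/MQ_cells; exists (s ++ t); split; first by rewrite all_cat s_gt0.
  by move=> d; rewrite mem_cat => /orP[/sQ|/tQ].
apply: similar_trans (similar_block Xs Yt) _.
exact/similar_sym/jordan_cells_cat.
Qed.

Lemma MQ_similar (F : fieldType) (n k : nat) (Q : {pred nat}) (X : 'M[F]_n) (Y : 'M[F]_k) :
  similar X Y -> MQ Q X -> MQ Q Y.
Proof.
move=> /similar_sym YX /MQ_cells [s [s_gt0 sQ Xs]]; apply/MQ_cells; exists s; split=> //.
exact: similar_trans YX Xs.
Qed.

(** The index of nilpotency is the size of the largest cell. *)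
Lemma MQ_index (F : fieldType) (n k : nat) (Q : {pred nat}) (X : 'M[F]_n) :
  MQ Q X -> X ^+ k != 0 -> X ^+ k.+1 = 0 -> (0 < k)%N -> k.+1 \in Q.
Proof.
move=> /MQ_cells [s [_ sQ Xs]] + /eqP + k_gt0.
rewrite !(similarX_eq0 _ Xs) !jordan_cellsX_eq0 => /allPn [d ds dk] /allP /(_ _ ds) dk1.
have dE : d = k.+1 by lia.
by case: (sQ d ds); rewrite dE //; lia.
Qed.

Lemma MQ_small_index (F : fieldType) (n m : nat) (Q : {pred nat}) (X : 'M[F]_n) :
  X ^+ m = 0 -> (forall d, 2 <= d <= m -> d \in Q)%N -> MQ Q X.
Proof.
move=> Xm mQ; apply/MQ_cells; have [s s_gt0 Xs] := nilpotent_similar_cells Xm.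
exists s; split=> // d ds; move/eqP: Xm; rewrite (similarX_eq0 _ Xs) jordan_cellsX_eq0.
move=> /allP /(_ _ ds) dm; have := allP s_gt0 _ ds.
by rewrite leq_eqVlt => /predU1P[<-|d2]; [right | left; apply: mQ; rewrite d2].
Qed.

Lemma mem_leq_sumn (s : seq nat) (d : nat) : d \in s -> (d <= sumn s)%N.
Proof. by elim: s => //= c s IHs; rewrite inE => /orP[/eqP ->|/IHs]; lia. Qed.

Lemma mem2_leq_sumn (s : seq nat) (c d : nat) :
  c \in s -> d \in s -> c != d -> (c + d <= sumn s)%N.
Proof.
elim: s => //= e s IHs; rewrite !inE.
move=> /predU1P[->|cs] /predU1P[->|ds] cd; first by rewrite eqxx in cd.
- by rewrite leq_add2l mem_leq_sumn.
- by rewrite addnC leq_add2l mem_leq_sumn.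
- by apply: leq_trans (IHs cs ds cd) (leq_addl _ _).
Qed.

(** One cell has the size of the nilpotency index; the others have to share the
    remaining dimensions. *)
Lemma MQ_large_index (F : fieldType) (n k : nat) (Q : {pred nat}) (X : 'M[F]_n) :
  X ^+ k != 0 -> X ^+ k.+1 = 0 -> k.+1 \in Q ->
  (forall d, 2 <= d <= n - k.+1 -> d \in Q)%N -> MQ Q X.
Proof.
move=> Xk Xk1 kQ nQ; apply/MQ_cells; have [s s_gt0 Xs] := nilpotent_similar_cells Xk1.
exists s; split=> // d ds; move: Xk; move/eqP: Xk1.
rewrite !(similarX_eq0 _ Xs) !jordan_cellsX_eq0 => /allP s_le /allPn [c cs ck].
have ck1 : c = k.+1 by have := s_le _ cs; lia.
have [->|dk] := eqVneq d k.+1; first by left.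
have := mem2_leq_sumn ds cs; rewrite ck1 -(similar_size Xs) => /(_ dk) dle.
have := allP s_gt0 _ ds.
rewrite leq_eqVlt => /predU1P[<-|d2]; [by right | left; apply: nQ; lia].
Qed.

(** * Commuting nilpotent matrices *)

(** If the rank did not drop, the row space of [M] would be invariant under [T]
    and mapped onto itself, which a nilpotent [T] allows only for zero. *)
Lemma rank_mul_nilpotent (F : fieldType) (n e : nat) (M T : 'M[F]_n) :
  T *m M = M *m T -> T ^+ e = 0 -> (\rank (M *m T) <= (\rank M).-1)%N.
Proof.
move=> TM Te; have [lt_r|ge_r] := ltnP (\rank (M *m T)) (\rank M); first by lia.
have MTM : (M *m T <= M)%MS by rewrite -TM submxMl.
have MMT : (M <= M *m T)%MS by rewrite -(geq_leqif (mxrank_leqif_sup MTM)).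
have MMTj j : (M <= M *m T ^+ j)%MS.
  elim: j => [|j IHj]; first by rewrite expr0 mulmx1.
  by rewrite exprS -mulmxE mulmxA; apply: submx_trans IHj (submxMr _ MMT).
have := MMTj e; rewrite Te mulmx0 submx0 => /eqP ->.
by rewrite mul0mx mxrank0.
Qed.

Lemma comm_mxX (F : fieldType) (n a : nat) (T U : 'M[F]_n) :
  T *m U = U *m T -> T *m U ^+ a = U ^+ a *m T.
Proof. exact: commrX. Qed.

(** In a space of dimension [n], a product of [n] factors taken from a commuting
    family of nilpotent maps vanishes: each factor lowers the rank. *)
Lemma comm_nilpotent_monomial_eq0 (F : fieldType) (n e e' a b : nat) (T U : 'M[F]_n) :
  T *m U = U *m T -> T ^+ e = 0 -> U ^+ e' = 0 -> (n <= a + b)%N ->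
  T ^+ a *m U ^+ b = 0.
Proof.
move=> TU Te Ue nab.
have rank_le : (\rank (T ^+ a *m U ^+ b) <= n - (a + b))%N.
  elim: b {nab} => [|b IHb].
    rewrite mulmx1 addn0; elim: a => [|a IHa].
      by rewrite expr0 subn0 rank_leq_row.
    rewrite exprSr -mulmxE.
    have := rank_mul_nilpotent (comm_mxX a (erefl (T *m T))) Te; lia.
  rewrite exprSr -mulmxE mulmxA.
  have := @rank_mul_nilpotent _ _ e' (T ^+ a *m U ^+ b) U; rewrite Ue.
  have -> : U *m (T ^+ a *m U ^+ b) = T ^+ a *m U ^+ b *m U.
    by rewrite mulmxA (comm_mxX _ (esym TU)) -!mulmxA (comm_mxX b (erefl (U *m U))).
  move=> /(_ (erefl _) (erefl _)); lia.
by apply/eqP; rewrite -mxrank_eq0; lia.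
Qed.

Lemma comm_nilpotentD (F : fieldType) (n e e' : nat) (X Y : 'M[F]_n) :
  X *m Y = Y *m X -> X ^+ e = 0 -> Y ^+ e' = 0 -> (X + Y) ^+ (e + e') = 0.
Proof.
move=> XY Xe Ye; rewrite exprDn_comm // big1 // => i _.
have [i_lt|i_ge] := ltnP i e'.
  have -> : (e + e' - i = e + (e' - i))%N by lia.
  by rewrite exprD Xe mul0r mul0r mul0rn.
by rewrite -[nat_of_ord i](subnK i_ge) exprD Ye mulr0 mulr0 mul0rn.
Qed.

Lemma expr_scalemx (F : fieldType) (n e : nat) (c : F) (X : 'M[F]_n) :
  (c *: X) ^+ e = c ^+ e *: X ^+ e.
Proof.
elim: e => [|e IHe]; first by rewrite !expr0 scale1r.
by rewrite !exprSr IHe -!mulmxE -scalemxAl -scalemxAr scalerA.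
Qed.

(** * The commutant of a nilpotent matrix with a dominant cell *)

(** A matrix commuting with the cell is a polynomial in it, with the entries of
    its first row as coefficients; the [c]-th power of the cell divides it when
    the first [c] coefficients vanish. *)
Lemma cell0_commutant (F : fieldType) (m c : nat) (A : 'M[F]_m.+1) :
  A *m cell0 F m.+1 = cell0 F m.+1 *m A -> (c <= m.+1)%N ->
  (forall j : 'I_m.+1, (j < c)%N -> A ord0 j = 0) ->
  exists S, A = S *m cell0 F m.+1 ^+ c.
Proof.
move=> AJ c_le A0; apply: (@cell0_factor _ _ _ _ (m.+1 - c)); last by rewrite subnKC.
set J := cell0 _ _ in AJ *; set M := A *m _.
have JM i : J ^+ i *m M = M *m J ^+ i.
  by rewrite /M mulmxA -(comm_mxX i AJ) -!mulmxA !mulmxE -!exprD addnC.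
apply/matrixP => i j.
have -> : M i j = (J ^+ i *m M) ord0 j.
  rewrite [RHS]mxE (bigD1 i) //= cell0X [in RHS]mxE /= addn0 eqxx mul1r big1 ?addr0 // => h.
  by rewrite mxE /= addn0 eq_sym => /negPf hi; rewrite val_eqE hi mul0r.
rewrite JM mxE big1 ?mxE // => h _; have [hc|hc] := ltnP h (m.+1 - c).
  by rewrite /M mul_cell0X_lt ?mul0r.
have hc' : (h - (m.+1 - c) < m.+1)%N by have := ltn_ord h; lia.
rewrite (mul_cell0X _ _ (h := Ordinal hc')) /= ?subnKC //.
by rewrite A0 ?mul0r //=; have := ltn_ord h; lia.
Qed.

Lemma mulmx_exprD (F : fieldType) (n a b : nat) (U : 'M[F]_n) :
  U ^+ a *m U ^+ b = U ^+ (a + b).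
Proof. by rewrite exprD. Qed.

Lemma mulmx_exprS (F : fieldType) (n a : nat) (U : 'M[F]_n) :
  U *m U ^+ a = U ^+ a.+1.
Proof. by rewrite exprS. Qed.

Lemma mulmx_exprSr (F : fieldType) (n a : nat) (U : 'M[F]_n) :
  U ^+ a *m U = U ^+ a.+1.
Proof. by rewrite exprSr. Qed.

(** In the next lemmas a nilpotent matrix commuting with
    [block_mx (cell0 F m) 0 0 T] is written [block_mx A B C U]. The cell and its
    complement, of sizes [m] and [D], carry one decreasing filtration each. *)

Definition cell_filtration (F : fieldType) (m k p : nat) (u : 'M[F]_(p, m)) :=
  exists u', u = u' *m cell0 F m ^+ k.

(** Membership at level [i] means being killed by all products of at least
    [D - i] factors [T] or [U]. All vectors have level 0 because such products
    vanish from [D] factors on; level [D] only contains 0. Defined by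
    annihilation, the levels are both sources that [C] maps deep into the cell
    and targets that [B] reaches. *)
Definition annihilator_filtration (F : fieldType) (D : nat) (T U : 'M[F]_D)
    (i p : nat) (w : 'M[F]_(p, D)) :=
  forall a b, (D <= i + a + b)%N -> w *m (T ^+ a *m U ^+ b) = 0.

Lemma cell_filtrationW (F : fieldType) (m k l p : nat) (u : 'M[F]_(p, m)) :
  (k <= l)%N -> cell_filtration l u -> cell_filtration k u.
Proof.
by move=> kl [u' ->]; exists (u' *m cell0 F m ^+ (l - k)); rewrite -mulmxA mulmx_exprD subnK.
Qed.

Lemma cell_filtrationD (F : fieldType) (m k p : nat) (u v : 'M[F]_(p, m)) :
  cell_filtration k u -> cell_filtration k v -> cell_filtration k (u + v).
Proof. by move=> [u' ->] [v' ->]; exists (u' + v'); rewrite mulmxDl. Qed.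

Lemma cell_filtration0 (F : fieldType) (m k p : nat) :
  cell_filtration k (0 : 'M[F]_(p, m)).
Proof. by exists 0; rewrite mul0mx. Qed.

Lemma cell_filtration_eq0 (F : fieldType) (m k p : nat) (u : 'M[F]_(p, m)) :
  (m <= k)%N -> cell_filtration k u -> u = 0.
Proof. by move=> mk [u' ->]; have /eqP-> := etrans (cell0X_eq0 F m k) mk; rewrite mulmx0. Qed.

Lemma annihilator_filtrationW (F : fieldType) (D : nat) (T U : 'M[F]_D)
    (i j p : nat) (w : 'M[F]_(p, D)) :
  (i <= j)%N -> annihilator_filtration T U j w -> annihilator_filtration T U i w.
Proof. by move=> ij wj a b Dab; apply: wj; lia. Qed.

Lemma annihilator_filtrationD (F : fieldType) (D : nat) (T U : 'M[F]_D)
    (i p : nat) (w w' : 'M[F]_(p, D)) :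
  annihilator_filtration T U i w -> annihilator_filtration T U i w' ->
  annihilator_filtration T U i (w + w').
Proof. by move=> wi wi' a b Dab; rewrite mulmxDl wi // wi' // addr0. Qed.

Lemma annihilator_filtration_eq0 (F : fieldType) (D : nat) (T U : 'M[F]_D)
    (i p : nat) (w : 'M[F]_(p, D)) :
  (D <= i)%N -> annihilator_filtration T U i w -> w = 0.
Proof. by move=> Di /(_ 0%N 0%N); rewrite !expr0 !mulmx1; apply; lia. Qed.

Lemma annihilator_filtrationM (F : fieldType) (D : nat) (T U : 'M[F]_D)
    (i p : nat) (w : 'M[F]_(p, D)) :
  T *m U = U *m T ->
  annihilator_filtration T U i w -> annihilator_filtration T U i.+1 (w *m U).
Proof.
move=> TU wi a b Dab; rewrite -mulmxA (mulmxA U) (comm_mxX a (esym TU)).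
by rewrite -mulmxA mulmx_exprS wi //; lia.
Qed.

Lemma expr_intertwine (F : fieldType) (m D k : nat) (B : 'M[F]_(m, D))
    (J : 'M[F]_m) (T : 'M[F]_D) :
  J *m B = B *m T -> J ^+ k *m B = B *m T ^+ k.
Proof.
move=> JB; elim: k => [|k IHk]; first by rewrite mul1mx mulmx1.
by rewrite -mulmx_exprS -mulmxA IHk mulmxA JB -mulmxA mulmx_exprS.
Qed.

(** [B] turns the powers of the cell into powers of [T], so it preserves levels. *)
Lemma cell_to_annihilator (F : fieldType) (m D e e' k p : nat) (u : 'M[F]_(p, m))
    (B : 'M[F]_(m, D)) (T U : 'M[F]_D) :
  cell0 F m *m B = B *m T ->
  T *m U = U *m T -> T ^+ e = 0 -> U ^+ e' = 0 ->
  cell_filtration k u -> annihilator_filtration T U k (u *m B).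
Proof.
move=> JB TU Te Ue [u' ->] a b Dab.
rewrite -(mulmxA u') (expr_intertwine k JB) -!mulmxA (mulmxA (T ^+ k)) mulmx_exprD.
by rewrite (comm_nilpotent_monomial_eq0 TU Te Ue) ?mulmx0 //; lia.
Qed.

(** A vector killed by [T ^ (D - i)] goes to a vector killed by the same power of
    the cell, hence divisible by its power of exponent [m - (D - i)]. *)
Lemma annihilator_to_cell (F : fieldType) (m D i k p : nat) (w : 'M[F]_(p, D))
    (C : 'M[F]_(D, m)) (T U : 'M[F]_D) :
  C *m cell0 F m = T *m C -> (k + D <= m + i)%N ->
  annihilator_filtration T U i w -> cell_filtration k (w *m C).
Proof.
move=> CJ kD wi; have [iD|Di] := leqP i D; last first.
  rewrite (annihilator_filtration_eq0 (ltnW Di) wi) mul0mx.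
  exact: cell_filtration0.
apply: (@cell0_factor _ _ _ _ (D - i)); last by lia.
rewrite -mulmxA -(expr_intertwine (D - i) (esym CJ)) mulmxA.
by have := wi (D - i)%N 0%N; rewrite expr0 mulmx1 => ->; rewrite ?mul0mx //; lia.
Qed.

(** As [C] has its image in that of the cell, the corner of a power is the power
    of the corner up to a multiple of [T]. Hence some power of [U] is a multiple
    of [T] commuting with the nilpotent [T]. *)
Lemma corner_nilpotent (F : fieldType) (m D e e' : nat) (A : 'M[F]_m)
    (B : 'M[F]_(m, D)) (C C' : 'M[F]_(D, m)) (T U : 'M[F]_D) :
  A *m cell0 F m = cell0 F m *m A -> cell0 F m *m B = B *m T ->
  C = C' *m cell0 F m -> T *m U = U *m T -> T ^+ e = 0 ->
  block_mx A B C U ^+ e' = 0 -> U ^+ (e' * e) = 0.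
Proof.
move=> AJ JB CE TU Te Ze.
have corner k : exists S R, dlsubmx (block_mx A B C U ^+ k) = S *m cell0 F m /\
    drsubmx (block_mx A B C U ^+ k) = U ^+ k + R *m T.
  elim: k => [|k [S [R [SE RE]]]].
    exists 0, 0; rewrite !mul0mx addr0 !expr0.
    by rewrite -!idmxE scalar_mx_block block_mxKdl block_mxKdr.
  rewrite exprSr -mulmxE -(submxK (block_mx A B C U ^+ k)) SE RE mulmx_block.
  rewrite block_mxKdl block_mxKdr.
  exists (S *m A + (U ^+ k + R *m T) *m C'), (S *m B + R *m U); split.
    by rewrite mulmxDl -!mulmxA AJ CE.
  rewrite !mulmxDl -!mulmxA JB TU exprSr -mulmxE.
  by rewrite !addrA; congr (_ + _); rewrite addrC.
have [S [R [_]]] := corner e'; rewrite Ze => RE.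
have {}RE : U ^+ e' = (- R) *m T.
  have R0 : U ^+ e' + R *m T = 0 by rewrite -RE; apply/matrixP => i j; rewrite !mxE.
  by rewrite mulNmx; apply/eqP; rewrite -addr_eq0 R0.
have TU' := comm_mxX e' TU.
rewrite exprM RE.
suff -> : (- R *m T) ^+ e = (- R) ^+ e *m T ^+ e by rewrite Te mulmx0.
elim: e {Te} => [|k IHk]; first by rewrite !expr0 mulmx1.
rewrite exprSr IHk -mulmxE -RE -mulmxA (expr_intertwine k TU') RE.
by rewrite -!mulmxA mulmx_exprS mulmxA mulmx_exprSr.
Qed.

(** The functions [f] and [g] re-index the two filtrations; the three
    inequalities are what [C], [B] and [U] need in order to map the [k]-th term
    of the combined filtration into the next one. *)
Lemma filtration_shift (F : fieldType) (m D e e' k p : nat) (f g : nat -> nat)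
    (A : 'M[F]_m) (B : 'M[F]_(m, D)) (C : 'M[F]_(D, m)) (T U : 'M[F]_D)
    (u : 'M[F]_(p, m)) (w : 'M[F]_(p, D)) :
  cell0 F m *m B = B *m T -> C *m cell0 F m = T *m C -> T *m U = U *m T ->
  T ^+ e = 0 -> U ^+ e' = 0 ->
  (cell_filtration (f k) u -> cell_filtration (f k.+1) (u *m A)) ->
  (f k.+1 + D <= m + g k)%N -> (g k.+1 <= f k)%N -> (g k.+1 <= (g k).+1)%N ->
  cell_filtration (f k) u -> annihilator_filtration T U (g k) w ->
  cell_filtration (f k.+1) (u *m A + w *m C) /\
  annihilator_filtration T U (g k.+1) (u *m B + w *m U).
Proof.
move=> JB CJ TU Te Ue fA fg gf gg uk wk; split.
  by apply: cell_filtrationD (fA uk) (annihilator_to_cell CJ fg wk).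
apply: annihilator_filtrationD.
  exact: annihilator_filtrationW gf (cell_to_annihilator JB TU Te Ue uk).
exact: annihilator_filtrationW gg (annihilator_filtrationM TU wk).
Qed.

Lemma filtered_nilpotent (F : fieldType) (m D e e' N : nat) (f g : nat -> nat)
    (A : 'M[F]_m) (B : 'M[F]_(m, D)) (C : 'M[F]_(D, m)) (T U : 'M[F]_D) :
  cell0 F m *m B = B *m T -> C *m cell0 F m = T *m C -> T *m U = U *m T ->
  T ^+ e = 0 -> U ^+ e' = 0 ->
  (forall k p (u : 'M_(p, m)), cell_filtration (f k) u -> cell_filtration (f k.+1) (u *m A)) ->
  (forall k, [/\ f k.+1 + D <= m + g k, g k.+1 <= f k & g k.+1 <= (g k).+1])%N ->
  f 0%N = 0%N -> g 0%N = 0%N -> (m <= f N)%N -> (D <= g N)%N ->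
  block_mx A B C U ^+ N = 0.
Proof.
move=> JB CJ TU Te Ue fA fg f0 g0 fN gN.
have filt k : cell_filtration (f k) (lsubmx (block_mx A B C U ^+ k)) /\
    annihilator_filtration T U (g k) (rsubmx (block_mx A B C U ^+ k)).
  elim: k => [|k [fk gk]].
    rewrite f0 g0; split; first by exists (lsubmx (block_mx A B C U ^+ 0)); rewrite expr0 mulmx1.
    by move=> a b Dab; rewrite (comm_nilpotent_monomial_eq0 TU Te Ue) ?mulmx0.
  have [h1 h2 h3] := fg k.
  rewrite exprSr -mulmxE -(hsubmxK (block_mx A B C U ^+ k)) mul_row_block.
  rewrite row_mxKl row_mxKr.
  exact: (filtration_shift JB CJ TU Te Ue (@fA k _ _) h1 h2 h3 fk gk).
have [fk gk] := filt N.
rewrite -(hsubmxK (block_mx A B C U ^+ N)) (cell_filtration_eq0 fN fk).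
by rewrite (annihilator_filtration_eq0 gN gk) row_mx0.
Qed.

Lemma commutant_cell_filtration (F : fieldType) (m k c p : nat) (A S : 'M[F]_m)
    (u : 'M[F]_(p, m)) :
  A *m cell0 F m = cell0 F m *m A -> A = S *m cell0 F m ^+ c ->
  cell_filtration k u -> cell_filtration (k + c) (u *m A).
Proof.
move=> AJ AE [u' ->]; exists (u' *m S).
rewrite -mulmxA -(comm_mxX k AJ) AE -!mulmxA mulmx_exprD.
by rewrite addnC.
Qed.

(** With [alpha] the linear coefficient of [A], the combined filtration with the
    identity on the cell shows that the index of [Z] is at most that of the cell,
    and the leading term [alpha ^ k] of its [k]-th power that it is not less when
    [alpha] is nonzero. When [alpha] vanishes, [A] moves two levels up at each
    step, which allows a faster filtration of the cell, of length [m0]. *)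
Lemma dominant_cell_commutant_block (F : fieldType) (m m0 D e e' : nat)
    (T : 'M[F]_D) (Z : 'M[F]_(m.+2 + D)) :
  (D + 2 <= m0 < m.+2)%N -> (m.+2 <= 2 * m0)%N ->
  T ^+ e = 0 -> Z ^+ e' = 0 ->
  block_mx (cell0 F m.+2) 0 0 T *m Z = Z *m block_mx (cell0 F m.+2) 0 0 T ->
  let alpha := Z (lshift D ord0) (lshift D (lift ord0 ord0)) in
  (alpha != 0 -> Z ^+ m.+1 != 0 /\ Z ^+ m.+2 = 0) /\ (alpha = 0 -> Z ^+ m0 = 0).
Proof.
move=> /andP[Dm0 m0m] m_le Te + +.
set J := cell0 F m.+2.
rewrite -(submxK Z); set A := ulsubmx Z; set B := ursubmx Z; set C := dlsubmx Z; set U := drsubmx Z.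
move: A B C U => A B C U {Z} Ze'.
rewrite !mulmx_block !(mul0mx, mulmx0, addr0, add0r) => /eq_block_mx[/esym AJ JB /esym CJ TU].
rewrite block_mxEul; set alpha := A _ _ => /=.
have TD k : (D <= k)%N -> T ^+ k = 0.
  move=> Dk; have := comm_nilpotent_monomial_eq0 (a := k) (b := 0%N) (erefl (T *m T)) Te Te.
  by rewrite addn0 expr0 mulmx1; apply.
have [C' CE] : exists C', C = C' *m J.
  have [||C' CE] := @cell0_factor _ _ _ 1%N m.+1 C; rewrite ?add1n //.
    by rewrite -(expr_intertwine m.+1 (esym CJ)) TD ?mul0mx //; lia.
  by exists C'; rewrite {1}CE expr1.
have Ue := corner_nilpotent AJ JB CE TU Te Ze'.
(* The last vector of the cell spans a line that is stable under [Z], with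
   eigenvalue the constant coefficient of [A]. *)
have A00 : A ord0 ord0 = 0.
  pose eps : 'rV_m.+2 := delta_mx 0 ord0 *m J ^+ m.+1.
  have epsB : eps *m B = 0.
    by rewrite -mulmxA (expr_intertwine _ JB) TD ?mulmx0 //; lia.
  have epsA : eps *m A = A ord0 ord0 *: eps.
    rewrite -mulmxA -(comm_mxX m.+1 AJ) mulmxA -rowE; apply/rowP => j.
    rewrite [RHS]mxE; have [j_lt|j_ge] := ltnP j m.+1.
      by rewrite !mul_cell0X_lt ?mulr0.
    have jm : (m.+1 + (ord0 : 'I_m.+2) = j)%N by have := ltn_ord j; rewrite /= addn0; lia.
    by rewrite !(mul_cell0X _ _ jm) !mxE !eqxx mulr1.
  have epsZ k : row_mx eps 0 *m block_mx A B C U ^+ k = A ord0 ord0 ^+ k *: row_mx eps 0.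
    elim: k => [|k IHk]; first by rewrite !expr0 mulmx1 scale1r.
    rewrite -mulmx_exprSr mulmxA IHk -scalemxAl mul_row_block !mul0mx !addr0 epsA epsB.
    by rewrite -[X in row_mx _ X](scaler0 _ (A ord0 ord0)) -scale_row_mx scalerA exprSr.
  move/eqP: (epsZ e'); rewrite Ze' mulmx0 eq_sym scaler_eq0 expf_eq0.
  move=> /orP[/andP[_ /eqP //]|]; rewrite row_mx_eq0 => /andP[/eqP/rowP/(_ ord_max)/eqP].
  rewrite (mul_cell0X _ _ (h := ord0)) ?mxE ?eqxx ?oner_eq0 //.
  by rewrite /= addn0.
have [S AS] : exists S, A = S *m J ^+ 1.
  apply: (cell0_commutant AJ) => // j; rewrite ltnS leqn0 => /eqP j0.
  by rewrite (_ : j = ord0) ?A00 //; apply: val_inj.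
have [S' AS'] : exists S', A - alpha *: J = S' *m J ^+ 2.
  apply: cell0_commutant => // [|j j_lt].
    by rewrite mulmxBl mulmxBr AJ -scalemxAl -scalemxAr.
  have [j0|j1] : j = ord0 \/ j = lift ord0 ord0.
  - by case: j j_lt => [[|[|]]] // ? _; [left | right]; apply: val_inj.
  - by rewrite j0 !mxE A00 /= mul0rn addr0 mulr0 subr0.
  - by rewrite j1 !mxE /= mul0rn add0r mulr1 subrr.
have A_shift k p (u : 'M_(p, m.+2)) :
    cell_filtration k u -> cell_filtration k.+1 (u *m A).
  by rewrite -(addn1 k); apply: commutant_cell_filtration AJ AS.
have Z_top : block_mx A B C U ^+ m.+2 = 0.
  apply: (filtered_nilpotent (f := id) (g := predn) JB CJ TU Te Ue) => //=; try lia.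
  by move=> k; split; lia.
split=> [alpha0|alpha0]; last first.
  rewrite alpha0 scale0r subr0 in AS'.
  (* The slope 2 comes from [A]; past [m.+2 - m0] the slope is 1, the rate
     at which [annihilator_to_cell] improves. At [m0] the level reaches the size
     of the cell. *)
  apply: (filtered_nilpotent (f := fun k => minn (2 * k) (m.+2 - m0 + k)) (g := predn)
    JB CJ TU Te Ue) => //=; try lia.
    move=> k p u /(commutant_cell_filtration AJ AS').
    by apply: cell_filtrationW; lia.
  by move=> k; split; lia.
split=> //; pose v : 'rV[F]_m.+2 := delta_mx 0 ord0.
have lead k : exists r w, [/\ row_mx v 0 *m block_mx A B C U ^+ k =
      row_mx (alpha ^+ k *: (v *m J ^+ k) + r) w,
    cell_filtration k.+1 r & annihilator_filtration T U k.-1 w].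
  elim: k => [|k [r [w [E rk wk]]]].
    exists 0, 0; rewrite !expr0 !mulmx1 scale1r addr0; split=> //.
      exact: cell_filtration0.
    by move=> a b _; rewrite mul0mx.
  rewrite -mulmx_exprSr mulmxA E mul_row_block.
  set u := _ + r.
  have uk : cell_filtration k u.
    apply: cell_filtrationD (cell_filtrationW (leqnSn k) rk).
    by exists (alpha ^+ k *: v); rewrite -scalemxAl.
  exists (alpha ^+ k *: (v *m J ^+ k) *m (A - alpha *: J) + r *m A + w *m C), (u *m B + w *m U).
  split.
  - have -> : alpha ^+ k.+1 *: (v *m J ^+ k.+1) =
        alpha ^+ k *: (v *m J ^+ k) *m (alpha *: J).
      by rewrite -scalemxAl -scalemxAr scalerA -exprSr -mulmxA mulmx_exprSr.
    rewrite mulmxBr mulmxDl; congr row_mx.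
    by rewrite [RHS]addrA [in RHS]addrA [in RHS]addrCA subrr addr0.
  - apply: cell_filtrationD; first apply: cell_filtrationD.
    + rewrite -(addn2 k); apply: commutant_cell_filtration AS' _.
        by rewrite mulmxBl mulmxBr AJ -scalemxAl -scalemxAr.
      by exists (alpha ^+ k *: v); rewrite -scalemxAl.
    + exact: A_shift.
    + by apply: annihilator_to_cell CJ _ wk; lia.
  - apply: annihilator_filtrationD.
      exact: cell_to_annihilator JB TU Te Ue uk.
    apply: annihilator_filtrationW (annihilator_filtrationM TU wk); lia.
apply/eqP => Z0; have [r [w [E rk _]]] := lead m.+1.
move: E; rewrite Z0 mulmx0 (cell_filtration_eq0 _ rk) // addr0.
move=> /esym/eqP; rewrite row_mx_eq0 => /andP[+ _].
rewrite scaler_eq0 expf_eq0 (negPf alpha0) /= => /eqP/rowP/(_ ord_max)/eqP.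
rewrite (mul_cell0X _ _ (h := ord0)) ?mxE ?eqxx ?oner_eq0 //.
by rewrite /= addn0.
Qed.

(** The same in an arbitrary basis. The form [alpha] is linear and normalised by
    [X], so if [X] is itself a combination of two commuting matrices, then
    [alpha] is nonzero on one of them. *)
Lemma dominant_cell_commutant (F : fieldType) (n k m0 : nat) (X : 'M[F]_n) :
  X ^+ k != 0 -> X ^+ k.+1 = 0 ->
  (n - k.+1 + 2 <= m0 <= k)%N -> (k.+1 <= 2 * m0)%N ->
  exists alpha : 'M[F]_n -> F,
    [/\ alpha X = 1,
        forall a b U V, alpha (a *: U + b *: V) = a * alpha U + b * alpha V
      & forall Z e, X *m Z = Z *m X -> Z ^+ e = 0 ->
        (alpha Z != 0 -> Z ^+ k != 0 /\ Z ^+ k.+1 = 0) /\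
        (alpha Z = 0 -> Z ^+ m0 = 0)].
Proof.
move=> Xk Xk1 m0_bounds k_le.
have [D [T XT]] := split_longest_cell Xk Xk1.
have nD := similar_size XT.
have Tk : T ^+ k.+1 = 0.
  move/eqP: Xk1; rewrite (similarX_eq0 _ XT) block_diagX block_diag_eq0.
  by move=> /andP[_ /eqP].
have [m km] : exists m, k = m.+1 by exists k.-1; lia.
subst k; move: XT; set Y := block_mx _ _ _ _ => -[P [R [PR RP XE]]].
pose coef (Z : 'M[F]_(m.+2 + D)) := Z (lshift D ord0) (lshift D (lift ord0 ord0)).
exists (fun Z => coef (R *m Z *m P)); split.
- rewrite XE -!mulmxA RP mulmx1 mulmxA RP mul1mx /coef block_mxEul !mxE /=.
  by rewrite mul0rn add0r.
- move=> a b V W; rewrite mulmxDr mulmxDl -!scalemxAr -!scalemxAl /coef.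
  by rewrite !mxE.
move=> Z e XZ Ze.
have ZE : similar Z (R *m Z *m P).
  by exists P, R; split=> //; rewrite !mulmxA PR mul1mx -mulmxA PR mulmx1.
have Ze' : (R *m Z *m P) ^+ e = 0.
  by apply/eqP; rewrite -(similarX_eq0 _ ZE) Ze.
have YZ : Y *m (R *m Z *m P) = (R *m Z *m P) *m Y.
  have YE : Y = R *m X *m P by rewrite XE !mulmxA RP mul1mx -mulmxA RP mulmx1.
  rewrite YE -!mulmxA (mulmxA P) PR mul1mx (mulmxA P) PR mul1mx.
  by rewrite (mulmxA X) XZ -!mulmxA.
have m0_bounds' : (D + 2 <= m0 < m.+2)%N by lia.
have [top low] := dominant_cell_commutant_block m0_bounds' k_le Tk Ze' YZ.
split=> [/top [Zk Zk1]|/low Zm]; last by apply/eqP; rewrite (similarX_eq0 _ ZE) Zm.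
by split; [rewrite (similarX_eq0 _ ZE) | apply/eqP; rewrite (similarX_eq0 _ ZE) Zk1].
Qed.

(** * Sufficiency *)

Lemma comm_mx_frobenius (F : fieldType) (n p k : nat) (X Y : 'M[F]_n.+1) :
  p \in [pchar F] -> X *m Y = Y *m X ->
  (X + Y) ^+ (p ^ k) = X ^+ (p ^ k) + Y ^+ (p ^ k).
Proof.
move=> pF XY; have pM : p \in [pchar 'M[F]_n.+1] by rewrite pchar_lalg.
elim: k => [|k IHk]; first by rewrite !expr1.
rewrite expnSr !exprM IHk -!(pFrobenius_autE pM) pFrobenius_autD_comm //.
by apply: commrX; apply: commr_sym; apply: commrX; apply: commr_sym.
Qed.

Lemma span_pair (F : fieldType) (n : nat) (X Y Z : 'M[F]_n) :
  Z \in <<[:: X; Y]>>%VS <-> exists a b, Z = a *: X + b *: Y.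
Proof.
rewrite span_cons span_seq1; split.
  by move=> /memv_addP [_ /vlineP [a ->] [_ /vlineP [b ->] ->]]; exists a, b.
by move=> [a [b ->]]; apply: memv_add; apply: memvZ; apply: memv_line.
Qed.

Lemma MQ_calM_sufficient (F : fieldType) (n m0 : nat) (Q : {pred nat}) :
  (0 < n)%N -> (forall m, m \in Q -> 2 <= m <= n)%N ->
  (2 <= m0 <= n %/ 2 + 1)%N ->
  m0 = (n %/ 2 + 1)%N \/
    (exists p k : nat, [/\ p \in [pchar F], (0 < k)%N & m0 = (p ^ k)%N]) ->
  (forall m, (2 <= m <= m0)%N -> m \in Q) ->
  (forall m, m \in Q -> m0 + 1 <= m <= n -> n - m0 + 2 <= m <= 2 * m0)%N ->
  calM (@MQ F n Q).
Proof.
move=> n_gt0 Qn m0_bounds m0_cases low high; split.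
- by move=> X [].
- by apply: (@MQ_small_index _ _ 1) => [|d]; [rewrite expr1 | lia].
- move=> g ug Y; split=> [[X QX ->]|QY].
    apply: MQ_similar QX; exists (invmx g), g; rewrite mulmxV ?mulVmx //.
    by split=> //; rewrite !mulmxA mulVmx // mul1mx -mulmxA mulVmx // mulmx1.
  exists (invmx g *m Y *m g).
    apply: MQ_similar QY; exists g, (invmx g); rewrite mulmxV ?mulVmx //.
    by split=> //; rewrite !mulmxA mulmxV // mul1mx -mulmxA mulmxV // mulmx1.
  by rewrite !mulmxA mulmxV // mul1mx -mulmxA mulmxV // mulmx1.
move=> X Y QX QY XY Z /span_pair [a [b ZE]].
have [[eX Xe] _] := QX; have [[eY Ye] _] := QY.
have XZ : X *m Z = Z *m X by rewrite ZE mulmxDl mulmxDr -!scalemxAl -!scalemxAr XY.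
have YZ : Y *m Z = Z *m Y by rewrite ZE mulmxDl mulmxDr -!scalemxAl -!scalemxAr XY.
have Ze : Z ^+ (eX + eY) = 0.
  rewrite ZE; apply: comm_nilpotentD; rewrite ?expr_scalemx ?Xe ?Ye ?scaler0 //.
  by rewrite -!scalemxAl -!scalemxAr XY !scalerA mulrC.
(* A member of [MQ Q] commuting with [Z] whose [m0]-th power is nonzero decides
   the Jordan type of [Z]. *)
have dominant U : MQ Q U -> U *m Z = Z *m U -> U ^+ m0 != 0 -> MQ Q Z.
  move=> QU UZ Um; have [[eU Ue] _] := QU.
  have [k Uk Uk1] := nilpotent_index n_gt0 Ue.
  have m0k : (m0 <= k)%N.
    rewrite leqNgt; apply/negP => km; move/eqP: Um; apply.
    by rewrite -(subnKC km) exprD Uk1 mul0r.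
  have kQ : k.+1 \in Q by apply: (MQ_index QU Uk Uk1); lia.
  have k_le := Qn _ kQ.
  have k_bounds : (n - m0 + 2 <= k.+1 <= 2 * m0)%N by apply: high => //; lia.
  have bounds : (n - k.+1 + 2 <= m0 <= k)%N by lia.
  have k_le2 : (k.+1 <= 2 * m0)%N by lia.
  have [alpha [_ _ /(_ Z _ UZ Ze) [top bot]]] := dominant_cell_commutant Uk Uk1 bounds k_le2.
  have [/bot Zm|/top [Zk Zk1]] := eqVneq (alpha Z) 0.
    exact: MQ_small_index Zm low.
  by apply: MQ_large_index Zk Zk1 kQ _ => d d_le; apply: low; lia.
have [Xm|Xm] := eqVneq (X ^+ m0) 0; last exact: dominant QX XZ Xm.
have [Ym|Ym] := eqVneq (Y ^+ m0) 0; last exact: dominant QY YZ Ym.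
suff Zm : Z ^+ m0 = 0 by apply: MQ_small_index Zm low.
case: m0_cases => [m0E|[p [k [pF _ m0E]]]]; last first.
  case: n n_gt0 X Y Z ZE XY Xm Ym {Qn m0_bounds high QX QY Xe Ye XZ YZ Ze dominant}
    => // n _ X Y Z -> XY Xm Ym.
  rewrite m0E comm_mx_frobenius // -?m0E ?expr_scalemx ?Xm ?Ym ?scaler0 ?addr0 //.
  by rewrite -!scalemxAl -!scalemxAr XY !scalerA mulrC.
apply/eqP; apply: contraT => Zm.
have [k Zk Zk1] := nilpotent_index n_gt0 Ze.
have m0k : (m0 <= k)%N.
  rewrite leqNgt; apply/negP => km; move/eqP: Zm; apply.
  by rewrite -(subnKC km) exprD Zk1 mul0r.
have k_lt : (k < n)%N.
  rewrite ltnNge; apply/negP => nk; move/eqP: Zk; apply.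
  have := comm_nilpotent_monomial_eq0 (a := k) (b := 0%N) (erefl (Z *m Z)) Ze Ze.
  by rewrite addn0 expr0 mulmx1; apply.
have bounds : (n - k.+1 + 2 <= m0 <= k)%N by rewrite m0E; lia.
have k_le : (k.+1 <= 2 * m0)%N by rewrite m0E; lia.
have [alpha [alphaZ alphaD alphaP]] := dominant_cell_commutant Zk Zk1 bounds k_le.
have killed U e : U *m Z = Z *m U -> U ^+ e = 0 -> U ^+ m0 = 0 -> alpha U = 0.
  move=> UZ Ue Um; apply/eqP; apply: contraT => /(proj1 (alphaP U e (esym UZ) Ue)) [Uk _].
  by move/eqP: Uk; case; rewrite -(subnKC m0k) exprD Um mul0r.
move/eqP: alphaZ; rewrite ZE alphaD (killed X eX) // (killed Y eY) //.
by rewrite !mulr0 addr0 eq_sym oner_eq0.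
Qed.

(** * Necessity *)

(** Padding with zeros moves a situation of any size [k <= n] to size [n]: cells
    of size 1 are always allowed. *)
Lemma calM_index (F : fieldType) (n k l i : nat) (Q : {pred nat}) (a b : F) (X Y : 'M[F]_k) :
  calM (@MQ F n Q) -> n = (k + l)%N ->
  MQ Q X -> MQ Q Y -> X *m Y = Y *m X ->
  (a *: X + b *: Y) ^+ i != 0 -> (a *: X + b *: Y) ^+ i.+1 = 0 -> (0 < i)%N ->
  i.+1 \in Q.
Proof.
move=> closedQ nE; subst n => QX QY XY.
have Q0 : MQ Q (0 : 'M[F]_l).
  by apply: (@MQ_small_index _ _ 1) => [|d]; [rewrite expr1 | lia].
have [_ _ _ /(_ _ _ (MQ_block QX Q0) (MQ_block QY Q0)) closed] := closedQ.
have {}closed : MQ Q (block_mx (a *: X + b *: Y) 0 0 (0 : 'M[F]_l)).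
  apply: closed; first by rewrite !mulmx_block !(mul0mx, mulmx0, addr0, add0r) XY.
  apply/span_pair; exists a, b.
  by rewrite !scale_block_mx add_block_mx !scaler0 !addr0.
move=> Zi Zi1; apply: (MQ_index closed); rewrite block_diagX.
  by rewrite block_diag_eq0 negb_and Zi.
by apply/eqP; rewrite block_diag_eq0 Zi1 exprS mul0r !eqxx.
Qed.

Lemma MQ_regular (F : fieldType) (m : nat) (Q : {pred nat}) (X : 'M[F]_m.+1) :
  X ^+ m != 0 -> X ^+ m.+1 = 0 -> m.+1 \in Q -> MQ Q X.
Proof. by move=> Xm Xm1 mQ; apply: MQ_large_index Xm Xm1 mQ _ => d; lia. Qed.

(** [J] and [J ^ j - J] both are a single cell up to similarity, and their sum
    [J ^ j] has index [i + 1], the upper integer part of [m / j]. *)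
Lemma calM_cell_power (F : fieldType) (n m i j : nat) (Q : {pred nat}) :
  calM (@MQ F n Q) -> (m <= n)%N -> m \in Q ->
  (1 < j)%N -> (0 < i)%N -> (j * i < m <= j * i.+1)%N -> i.+1 \in Q.
Proof.
move=> closedQ mn mQ j_gt1 i_gt0 ij; have m_gt0 : (0 < m)%N by case/andP: ij => ij _; apply: leq_ltn_trans ij.
case: m => // m in mn mQ ij m_gt0 *.
set J := cell0 F m.+1.
have Jm1 k : (m < k)%N -> J ^+ k = 0 by move=> mk; apply/eqP; rewrite cell0X_eq0.
have Jm : J ^+ m != 0 by rewrite cell0X_eq0 ltnn.
have YE k : (J ^+ j - J) ^+ k = (J ^+ j.-1 - 1) ^+ k * J ^+ k.
  rewrite -exprMn_comm; first by rewrite mulrBl mul1r -exprSr prednK // ltnW.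
  by apply: commr_sym; apply: commrB; [apply: commrX | apply: commr1].
have Ym k : (J ^+ j.-1 - 1) ^+ k * J ^+ m = (-1) ^+ k *: J ^+ m.
  elim: k => [|k IHk]; first by rewrite !expr0 mul1r scale1r.
  rewrite exprSr -mulrA mulrBl -exprD (Jm1 (j.-1 + m)%N); last by lia.
  by rewrite sub0r mul1r mulrN IHk exprS -scalerA scaleN1r.
apply: (@calM_index _ _ _ (n - m.+1) i _ 1 1 J (J ^+ j - J) closedQ) => //.
- by rewrite subnKC.
- by apply: MQ_regular mQ => //; apply: Jm1.
- apply: MQ_regular mQ; rewrite YE; last by rewrite (Jm1 m.+1) // mulr0.
  by rewrite Ym scaler_eq0 signr_eq0.
- by rewrite mulmxE mulrBl mulrBr -exprS -exprSr.
- by rewrite !scale1r addrC subrK -exprM cell0X_eq0; lia.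
- by rewrite !scale1r addrC subrK -exprM Jm1 //; lia.
Qed.

(* Innermost conditions come first, so that no condition contains a test. *)
Ltac split_ifs :=
  repeat match goal with |- context [if ?b then _ else _] =>
    lazymatch b with
    | context [if _ then _ else _] => fail
    | _ => case: (boolP b) => ? /=
    end
  end.

(** Two chains with common ends: [x] runs through [0, 1, ..., r - 1] and jumps to
    the last index [r + s - 1], whereas [y] jumps from [0] to [r] and then runs
    through [r, ..., r + s - 1]. *)
Lemma crossing_chains (F : fieldType) (r s : nat) : (0 < r)%N -> (0 < s)%N ->
  exists x y : 'M[F]_(r + s), [/\ x *m y = 0, y *m x = 0, x ^+ r = y ^+ s & x ^+ r != 0].
Proof.
move=> r_gt0 s_gt0.
pose f i := (if i < r.-1 then i.+1 else if i == r.-1 then r + s.-1 else r + s)%N.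
pose g i := (if i == 0 then r else if i < r then r + s else minn i.+1 (r + s))%N.
have fE k i : (i < r + s)%N -> iter k f i =
    (if k == 0 then i else if i + k < r then i + k
     else if i + k == r then r + s.-1 else r + s)%N.
  move=> i_lt; elim: k => [|k IHk] //=; rewrite IHk /f; split_ifs; lia.
have gE k i : (i < r + s)%N -> iter k g i =
    (if k == 0 then i else if i == 0 then minn (r + k.-1) (r + s)
     else if i < r then r + s else minn (i + k) (r + s))%N.
  move=> i_lt; elim: k => [|k IHk] //=; rewrite IHk /g; split_ifs; lia.
have f_out i : (r + s <= i -> r + s <= f i)%N by rewrite /f; split_ifs; lia.
have g_out i : (r + s <= i -> r + s <= g i)%N by rewrite /g; split_ifs; lia.
exists (fun_mx F _ f), (fun_mx F _ g); split.
- by rewrite fun_mxM // fun_mx_eq0 // => i _ /=; rewrite /g /f; split_ifs; lia.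
- by rewrite fun_mxM // fun_mx_eq0 // => i _ /=; rewrite /g /f; split_ifs; lia.
- by rewrite !fun_mxX //; apply: eq_fun_mx => i i_lt; rewrite fE // gE //; split_ifs; lia.
- by rewrite fun_mxX // (@fun_mx_neq0 _ _ _ 0%N) // ?fE; split_ifs; lia.
Qed.

Lemma annihilating_exprM (F : fieldType) (n k : nat) (x y : 'M[F]_n) :
  x *m y = 0 -> (0 < k)%N -> x ^+ k *m y = 0.
Proof. by move=> xy; case: k => // k _; rewrite -mulmx_exprSr -mulmxA xy mulmx0. Qed.

Lemma annihilating_exprD (F : fieldType) (n k : nat) (a b : F) (x y : 'M[F]_n) :
  x *m y = 0 -> y *m x = 0 -> (0 < k)%N ->
  (a *: x + b *: y) ^+ k = a ^+ k *: x ^+ k + b ^+ k *: y ^+ k.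
Proof.
move=> xy yx; case: k => // k _; elim: k => [|k IHk]; first by rewrite !expr1.
rewrite exprSr IHk -mulmxE mulmxDl !mulmxDr -!scalemxAl -!scalemxAr.
rewrite -(mulmx_exprSr k x) -(mulmxA _ x y) xy -(mulmx_exprSr k y) -(mulmxA _ y x) yx.
by rewrite !mulmx0 !scaler0 addr0 add0r !scalerA -!exprSr !mulmx_exprSr.
Qed.

(** For a prime [q] dividing [m], the polynomial [1 + X + ... + X ^ (q - 1)] has
    a root; it is a root of unity of order dividing [q], and it can be 1 only if
    [q] is the characteristic. *)
Lemma closed_root_of_unity (F : closedFieldType) (m : nat) :
  (1 < m)%N -> (exists2 z : F, z != 1 & z ^+ m = 1) \/
  (exists p k : nat, [/\ p \in [pchar F], (0 < k)%N & m = (p ^ k)%N]).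
Proof.
move=> m_gt1.
have prime_case q : q \in primes m -> (exists2 z : F, z != 1 & z ^+ m = 1) \/ q \in [pchar F].
  rewrite mem_primes => /and3P[q_pr _ /dvdnP [m' ->]].
  have /closed_rootP [z] : size (\poly_(i < q) (1 : F)) != 1%N.
    by rewrite size_poly_eq ?oner_neq0 // neq_ltn prime_gt1 ?orbT.
  rewrite /root horner_poly (eq_bigr (fun i : 'I_q => z ^+ i)) => [/eqP z_sum|i _]; last first.
    by rewrite mul1r.
  have zq : z ^+ q = 1.
    by apply/eqP; rewrite -subr_eq0 subrX1 z_sum mulr0.
  have [z1|z_neq1] := eqVneq z 1; last first.
    by left; exists z => //; rewrite mulnC exprM zq expr1n.
  right; rewrite inE q_pr /= -z_sum z1.
  rewrite (eq_bigr (fun=> 1)) => [|i _]; last by rewrite expr1n.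
  by rewrite sumr_const card_ord.
have [[z z1 zm]|all_char] : (exists2 z : F, z != 1 & z ^+ m = 1) \/
    {in primes m, forall q, q \in [pchar F]}.
  elim: (primes m) prime_case => [|q s IHs] prime_case; first by right.
  have [|//|qF] := prime_case q; first by rewrite inE eqxx.
  - by left.
  have [q' q's| |sF] := IHs; first by apply: prime_case; rewrite inE q's orbT.
    by left.
  by right=> q'; rewrite inE => /predU1P[->|/sF].
- by left; exists z.
right; pose p := pdiv m.
have pF : p \in [pchar F] by apply: all_char; rewrite mem_primes pdiv_prime ?pdiv_dvd // ltnW.
have : p.-nat m.
  rewrite -(eq_pnat _ (pcharf_eq pF)); apply/andP; split; first exact: ltnW.
  by apply/allP.
move=> /p_natP [k mE]; exists p, k; split=> //.
by case: k mE => // mE; rewrite mE in m_gt1.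
Qed.

(** Here [b] and [b z] are two scalars whose [m]-th power is -1, and [xE] solves
    for [x] in terms of [x + b y] and [x + b z y]. *)
Lemma calM_prime_power (F : closedFieldType) (n m : nat) (Q : {pred nat}) :
  calM (@MQ F n Q) -> (1 < m)%N -> (2 * m <= n)%N ->
  (forall d, (2 <= d <= m)%N -> d \in Q) -> m.+1 \notin Q ->
  exists p k : nat, [/\ p \in [pchar F], (0 < k)%N & m = (p ^ k)%N].
Proof.
move=> closedQ m_gt1 mn low mQ.
have [[z z_neq1 zm]|//] := closed_root_of_unity F m_gt1.
case/negP: mQ; have m_gt0 := ltnW m_gt1.
have /closed_rootP [b] : size ('X^m - (-1)%:P : {poly F}) != 1%N.
  by rewrite size_XnsubC //; lia.
rewrite /root !hornerE subr_eq0 => /eqP bm.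
have [x [y [xy yx xm x_neq0]]] := crossing_chains F m_gt0 m_gt0.
have MQ_line c : c ^+ m = -1 -> MQ Q (1 *: x + c *: y).
  move=> cm; apply: MQ_small_index low.
  by rewrite annihilating_exprD // cm xm expr1n scale1r scaleN1r subrr.
have z1 : z - 1 != 0 by rewrite subr_eq0.
have xE : z / (z - 1) *: (1 *: x + b *: y) + - (z - 1)^-1 *: (1 *: x + (b * z) *: y) = x.
  rewrite !scalerDr !scalerA addrACA -!scalerDl.
  have -> : z / (z - 1) * 1 + - (z - 1)^-1 * 1 = 1 by field.
  have -> : z / (z - 1) * b + - (z - 1)^-1 * (b * z) = 0 by field.
  by rewrite scale1r scale0r addr0.
apply: (calM_index (l := n - (m + m)) (a := z / (z - 1)) (b := - (z - 1)^-1)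
  closedQ _ (MQ_line b bm) (MQ_line (b * z) _)).
- by rewrite subnKC // addnn -mul2n.
- by rewrite exprMn bm zm mulr1.
- rewrite !mulmxDl !mulmxDr -!scalemxAl -!scalemxAr xy yx !scaler0 !addr0 !add0r.
  by rewrite !scalerA (mulrC b).
- by rewrite xE.
- by rewrite xE exprSr xm -mulmxE annihilating_exprM.
- exact: m_gt0.
Qed.

(** If [m' <= n - m + 1], the crossing chains of lengths [m' - 1] and [m] fit
    into size [n]. There [x] and [y - x] have index [m'], which leaves at most
    [m - 1] dimensions for their other cells, while [y] has index [m + 1]. *)
Lemma calM_gap (F : fieldType) (n m m' : nat) (Q : {pred nat}) :
  calM (@MQ F n Q) -> (0 < m)%N -> (forall d, (2 <= d <= m)%N -> d \in Q) ->
  m.+1 \notin Q -> m' \in Q -> (m < m')%N -> (n - m + 2 <= m')%N.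
Proof.
move=> closedQ m_gt0 low mQ m'Q mm'; rewrite leqNgt; apply/negP => m'n.
have m'_neq : m' != m.+1 by apply: contraNneq mQ => <-.
case/negP: mQ.
have m'_gt0 : (0 < m'.-1)%N by lia.
have [x [y [xy yx xm x_neq0]]] := crossing_chains F m'_gt0 m_gt0.
have m'E : m' = m'.-1.+1 by rewrite prednK // (leq_trans _ mm').
have xm' : x ^+ m'.-1.+1 = 0 by rewrite exprSr xm -mulmxE annihilating_exprM.
have ym1 k : (m < k)%N -> y ^+ k = 0.
  move=> mk; rewrite -(subnKC mk) exprD (_ : y ^+ m.+1 = 0) ?mul0r //.
  by rewrite exprSr -xm -mulmxE annihilating_exprM.
have low' d : (2 <= d <= m'.-1 + m - m'.-1.+1)%N -> d \in Q by move=> ?; apply: low; lia.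
have m'Q' : m'.-1.+1 \in Q by rewrite -m'E.
have QL : MQ Q ((-1) *: x + 1 *: y).
  have LX k := @annihilating_exprD _ _ k (-1) 1 _ _ xy yx.
  apply: MQ_large_index m'Q' low'.
    rewrite LX // (ym1 m'.-1); last by lia.
    by rewrite scaler0 addr0 scaler_eq0 signr_eq0.
  by rewrite LX // xm' ym1 ?scaler0 ?addr0 //; lia.
have Qx : MQ Q x by apply: MQ_large_index x_neq0 xm' m'Q' low'.
have yE : 1 *: x + 1 *: ((-1) *: x + 1 *: y) = y.
  by rewrite !scale1r scaleN1r addrA subrr add0r.
apply: (calM_index (l := n - (m'.-1 + m)) (a := 1) (b := 1) closedQ _ Qx QL).
- by rewrite subnKC //; lia.
- by rewrite mulmxDl mulmxDr -!scalemxAl -!scalemxAr xy yx.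
- by rewrite yE -xm.
- by rewrite yE ym1.
- exact: m_gt0.
Qed.

Lemma MQ_calM_necessary (F : closedFieldType) (n : nat) (Q : {pred nat}) :
  (forall m, m \in Q -> 2 <= m <= n)%N -> (exists m, m \in Q) ->
  calM (@MQ F n Q) ->
  exists m0 : nat,
    [/\ (2 <= m0 <= n %/ 2 + 1)%N,
        m0 = (n %/ 2 + 1)%N \/
          (exists p k : nat, [/\ p \in [pchar F], (0 < k)%N & m0 = (p ^ k)%N]),
        forall m, (2 <= m <= m0)%N -> m \in Q
      & forall m, m \in Q -> (m0 + 1 <= m <= n -> n - m0 + 2 <= m <= 2 * m0)%N].
Proof.
move=> Qn [m mQ] closedQ.
have Q2 : 2 \in Q.
  have [<- //|m_neq2] := eqVneq m 2.
  by apply: (calM_cell_power closedQ _ mQ (j := m.-1) (i := 1)); have := Qn m mQ; lia.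
pose initial m0 := (2 <= m0 <= n %/ 2 + 1)%N && all (mem Q) (iota 2 m0.-1).
have initialP m0 : initial m0 ->
    (2 <= m0 <= n %/ 2 + 1)%N /\ forall d, (2 <= d <= m0)%N -> d \in Q.
  move=> /andP[m0_bounds /allP m0Q]; split=> // d d_le; apply: m0Q.
  by rewrite mem_iota; lia.
have initial2 : exists m0, initial m0.
  by exists 2; rewrite /initial /= Q2; have := Qn 2 Q2; lia.
have initial_le m0 : initial m0 -> (m0 <= n %/ 2 + 1)%N by move=> /initialP [/andP[]].
case: (ex_maxnP initial2 initial_le) => m0 /initialP [m0_bounds low] m0_max.
have m0Q : m0 != (n %/ 2 + 1)%N -> m0.+1 \notin Q.
  move=> m0_neq; apply/negP => m0Q; suff /m0_max : initial m0.+1 by rewrite ltnn.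
  apply/andP; split; first by lia.
  apply/allP => d; rewrite mem_iota => d_bounds.
  by have [->//|d_neq] := eqVneq d m0.+1; apply: low; lia.
exists m0; split=> //; have [m0E|m0_neq] := eqVneq m0 (n %/ 2 + 1)%N.
- by left.
- by right; apply: (calM_prime_power closedQ) => //; try lia; apply: m0Q.
- by move=> d dQ; rewrite m0E; lia.
have {}m0Q := m0Q m0_neq.
move=> d dQ d_bounds; have d_ge : (n - m0 + 2 <= d)%N.
  by apply: (calM_gap closedQ) => //; lia.
rewrite d_ge leqNgt; apply/negP => d_gt.
have hQ : d.-1./2.+1 \in Q.
  by apply: (calM_cell_power closedQ _ dQ (j := 2)); lia.
(* [d.-1./2.+1] is half of [d], rounded up. *)
have : (n - m0 + 2 <= d.-1./2.+1)%N by apply: (calM_gap closedQ) => //; lia.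
lia.
Qed.

Local Close Scope ring_scope.

Theorem theorem1p2 (F : closedFieldType) (n : nat) (n_gt0 : 0 < n)
    (Q : {pred nat}) (Q_sub : forall m, m \in Q -> 2 <= m <= n)
    (Q_neq0 : exists m, m \in Q) :
  calM (@MQ F n Q) <->
  exists m0 : nat,
    [/\ 2 <= m0 <= n %/ 2 + 1,
        m0 = n %/ 2 + 1 \/
          (exists p k : nat, [/\ p \in [pchar F]%R, 0 < k & m0 = p ^ k]),
        forall m, 2 <= m <= m0 -> m \in Q
      & forall m, m \in Q -> m0 + 1 <= m <= n -> n - m0 + 2 <= m <= 2 * m0].
Proof.
split; first exact: MQ_calM_necessary.
move=> [m0 [m0_bounds m0_cases low high]].
exact: MQ_calM_sufficient n_gt0 Q_sub m0_bounds m0_cases low high.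
Qed.
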